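(* Let $G$ be a finite group and let $\alpha:\mathbf{B}G\to\mathbf{B}^3U(1)$ be the background field of Dijkgraaf–Witten theory, i.e. a $U(1)$-valued group 3-cocycle on $G$ (with the conventions given in the context). Then the transgression of $\alpha$ to the mapping space out of $\Sigma=\mathbf{B}\mathbb{Z}$, $$\tau_{\mathbf{B}\mathbb{Z}}\alpha := \mathrm{hom}(\mathbf{B}\mathbb{Z},\alpha)_1 : \Lambda G\to \mathbf{B}^2U(1),\qquad \Lambda G:=\mathrm{hom}(\mathbf{B}\mathbb{Z},\mathbf{B}G),$$ is the groupoid 2-cocycle on $\Lambda G$ known as the twist of the Drinfeld double, namely $$(\tau_{\mathbf{B}\mathbb{Z}}\alpha):\Big(x\xrightarrow{\,g\,}gxg^{-1}\xrightarrow{\,h\,}(hg)x(hg)^{-1}\Big)\longmapsto \frac{\alpha(x,g,h)\;\alpha\big(g,h,(hg)x(hg)^{-1}\big)}{\alpha(g,gxg^{-1},h)}$$ for all $x,g,h\in G$.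
   Context: For a finite group $G$, $\mathbf{B}G$ denotes the one-object groupoid with morphisms $G$ (equivalently its nerve, a Kan complex). The composite of $g$ followed by $h$ is $hg$. The 3-simplex $(g,h,k)$ of the nerve is the one with consecutive edges $g$, then $h$, then $k$ (total composite $khg$). $\mathbf{B}^3U(1)$ is the $\infty$-groupoid with $U(1)$ in degree 3 and trivial otherwise. A morphism $\alpha:\mathbf{B}G\to\mathbf{B}^3U(1)$ is a function $\alpha:G^3\to U(1)$, trivial on degenerate simplices, with $$\alpha(g,h,k)\,\alpha(g,kh,l)\,\alpha(h,k,l)=\alpha(hg,k,l)\,\alpha(g,h,lk)\quad\text{for all }g,h,k,l\in G.$$ $\Lambda G=\mathrm{hom}(\mathbf{B}\mathbb{Z},\mathbf{B}G)$ is the functor groupoid. Its objects are the elements $x\in G$ (the image of the generator $1\in\mathbb{Z}$) and its morphisms are $x\xrightarrow{g}gxg^{-1}$ for $x,g\in G$, with composition given by multiplication. Transgression: applying the internal hom $\mathrm{hom}(\mathbf{B}\mathbb{Z},-)$ to $\alpha$ gives a morphism $\Lambda G\to\mathrm{hom}(\mathbf{B}\mathbb{Z},\mathbf{B}^3U(1))$. The subscript $1$ denotes its component in $\mathbf{B}^2U(1)$ obtained by evaluation over the generating 1-cell of $\mathbf{B}\mathbb{Z}$. Explicitly, a pair of composable morphisms $x\xrightarrow{g}gxg^{-1}\xrightarrow{h}(hg)x(hg)^{-1}$ of $\Lambda G$ determines, via the evaluation map $\mathbf{B}\mathbb{Z}\times\Lambda G\to\mathbf{B}G$, a prism $\Delta^1\times\Delta^2\to\mathbf{B}G$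 whose $\Delta^1$-direction edges are $x$, $gxg^{-1}$, $(hg)x(hg)^{-1}$ and whose two triangular faces are $(g,h)$. Then $\tau_{\mathbf{B}\mathbb{Z}}\alpha$ sends the pair to the value of $\alpha$ on this prism, i.e. on the 3-chain which is the Eilenberg–Zilber shuffle product of the 1-cell of the $\Delta^1$-factor with the 2-cell of the $\Delta^2$-factor (in this order, with the standard shuffle signs, written multiplicatively in $U(1)$). A $U(1)$-valued groupoid 2-cocycle is a function on composable pairs of morphisms satisfying the usual cocycle identity on composable triples. *)

(* Defs.v *)
From HB Require Import structures.
From mathcomp Require Import all_boot all_order all_algebra fingroup.
From mathcomp Require Import boolp reals complex.

Set Implicit Arguments.
Unset Strict Implicit.
Unset Printing Implicit Defensive.

Import Order.TTheory GRing.Theory Num.Theory.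

Section UnitCircle.
Local Open Scope ring_scope.
Variable R : realType.

Record U1 := MkU1 { U1val : R[i]; U1valP : `|U1val| == 1 }.

HB.instance Definition _ := [isSub for U1val].
HB.instance Definition _ := [Choice of U1 by <:].

Definition U1one : U1 := MkU1 (introT eqP (@normr1 R[i])).

Fact U1inv_subproof (z : U1) : `|(U1val z)^-1| == 1.
Proof. by rewrite normfV (eqP (U1valP z)) invr1. Qed.
Definition U1inv (z : U1) : U1 := MkU1 (U1inv_subproof z).

Fact U1mul_subproof (z w : U1) : `|U1val z * U1val w| == 1.
Proof. by rewrite normrM (eqP (U1valP z)) (eqP (U1valP w)) mulr1. Qed.
Definition U1mul (z w : U1) : U1 := MkU1 (U1mul_subproof z w).

Fact U1_neq0 (z : U1) : U1val z != 0.
Proof. by rewrite -normr_eq0 (eqP (U1valP z)) oner_eq0. Qed.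

Fact U1mulA : associative U1mul.
Proof. by move=> x y z; apply/val_inj/mulrA. Qed.
Fact U1mul1 : left_id U1one U1mul.
Proof. by move=> x; apply/val_inj/mul1r. Qed.
Fact U1mulr1 : right_id U1one U1mul.
Proof. by move=> x; apply/val_inj/mulr1. Qed.
Fact U1mulV : left_inverse U1one U1inv U1mul.
Proof. by move=> x; apply/val_inj/mulVf/U1_neq0. Qed.
Fact U1mulrV : right_inverse U1one U1inv U1mul.
Proof. by move=> x; apply/val_inj/divff/U1_neq0. Qed.

HB.instance Definition _ :=
  isGroup.Build U1 U1mulA U1mul1 U1mulr1 U1mulV U1mulrV.

Fact U1mulC : commutative (@mul U1).
Proof. by move=> x y; apply/val_inj/mulrC. Qed.

HB.instance Definition _ :=
  SemiGroup.isCommutativeLaw.Build U1 (@mul U1) U1mulC.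

End UnitCircle.

Local Open Scope group_scope.

(* Composition is in diagrammatic order: [seqm f g] is [f] followed by [g]. *)

Record category := Category {
  ob :> Type;
  mor : ob -> ob -> Type;
  idm : forall a, mor a a;
  seqm : forall a b c, mor a b -> mor b c -> mor a c;
  seq1m : forall a b (f : mor a b), seqm (idm a) f = f;
  seqm1 : forall a b (f : mor a b), seqm f (idm b) = f;
  seqmA : forall a b c d (f : mor a b) (g : mor b c) (h : mor c d),
    seqm f (seqm g h) = seqm (seqm f g) h }.

Record groupoid := Groupoid {
  gcat :> category;
  invm : forall a b : gcat, mor a b -> mor b a;
  seqVm : forall (a b : gcat) (f : mor a b), seqm (invm f) f = idm b;
  seqmV : forall (a b : gcat) (f : mor a b), seqm f (invm f) = idm a }.

Record functor (C D : category) := Functor {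
  fob :> C -> D;
  fmap : forall a b : C, mor a b -> mor (fob a) (fob b);
  fmap1 : forall a : C, fmap (idm a) = idm (fob a);
  fmapM : forall (a b c : C) (f : mor a b) (g : mor b c),
    fmap (seqm f g) = seqm (fmap f) (fmap g) }.

Section FunctorComposition.
Variables (C D E : category) (F : functor C D) (K : functor D E).

Fact fcomp1 (a : C) : fmap K (fmap F (idm a)) = idm (K (F a)).
Proof. by rewrite !fmap1. Qed.
Fact fcompM (a b c : C) (f : mor a b) (g : mor b c) :
  fmap K (fmap F (seqm f g)) = seqm (fmap K (fmap F f)) (fmap K (fmap F g)).
Proof. by rewrite !fmapM. Qed.

Definition fcomp : functor C E := Functor fcomp1 fcompM.
End FunctorComposition.

Section ProductCategory.
Variables C D : category.
Let prod_hom (a b : C * D) : Type := mor a.1 b.1 * mor a.2 b.2.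
Let prod_idm (a : C * D) : prod_hom a a := (idm a.1, idm a.2).
Let prod_seqm (a b c : C * D) (f : prod_hom a b) (g : prod_hom b c) :
  prod_hom a c := (seqm f.1 g.1, seqm f.2 g.2).

Fact prod_seq1m a b (f : prod_hom a b) : prod_seqm (prod_idm a) f = f.
Proof. by case: f => f1 f2; rewrite /prod_seqm !seq1m. Qed.
Fact prod_seqm1 a b (f : prod_hom a b) : prod_seqm f (prod_idm b) = f.
Proof. by case: f => f1 f2; rewrite /prod_seqm !seqm1. Qed.
Fact prod_seqmA a b c d
    (f : prod_hom a b) (g : prod_hom b c) (h : prod_hom c d) :
  prod_seqm f (prod_seqm g h) = prod_seqm (prod_seqm f g) h.
Proof. by rewrite /prod_seqm !seqmA. Qed.

Definition prodcat : category := Category prod_seq1m prod_seqm1 prod_seqmA.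
End ProductCategory.

Section ProductFunctor.
Variables (A B C D : category) (F : functor A C) (K : functor B D).
Let pf_ob (a : prodcat A B) : prodcat C D := (F a.1, K a.2).
Let pf_map (a b : prodcat A B) (f : mor a b) : mor (pf_ob a) (pf_ob b) :=
  (fmap F f.1, fmap K f.2).

Fact prodfun1 a : pf_map (idm a) = idm (pf_ob a).
Proof. by rewrite /pf_map !fmap1. Qed.
Fact prodfunM a b c (f : mor a b) (g : mor b c) :
  pf_map (seqm f g) = seqm (pf_map f) (pf_map g).
Proof. by rewrite /pf_map !fmapM. Qed.

Definition prodfun : functor (prodcat A B) (prodcat C D) :=
  Functor prodfun1 prodfunM.
End ProductFunctor.

Record nattrans (C D : category) (F K : functor C D) := NatTrans {
  ntob :> forall a : C, mor (F a) (K a);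
  ntP : forall (a b : C) (f : mor a b),
    seqm (fmap F f) (ntob b) = seqm (ntob a) (fmap K f) }.

Lemma nattransP (C D : category) (F K : functor C D) (s t : nattrans F K) :
  (forall a, s a = t a) -> s = t.
Proof.
case: s t => [s sP] [t tP] /= st.
have {st} st : s = t by apply: functional_extensionality_dep.
by subst t; congr NatTrans; apply: Prop_irrelevance.
Qed.

Section FunctorGroupoid.
Variables (C : category) (D : groupoid).
Implicit Types F K L M : functor C D.

Fact nt1_subproof F (a b : C) (f : mor a b) :
  seqm (fmap F f) (idm (F b)) = seqm (idm (F a)) (fmap F f).
Proof. by rewrite seq1m seqm1. Qed.
Let nt1 F : nattrans F F := NatTrans (@nt1_subproof F).

Fact ntM_subproof F K L (s : nattrans F K) (t : nattrans K L)
    (a b : C) (f : mor a b) :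
  seqm (fmap F f) (seqm (s b) (t b)) = seqm (seqm (s a) (t a)) (fmap L f).
Proof. by rewrite seqmA ntP -seqmA ntP seqmA. Qed.
Let ntM F K L (s : nattrans F K) (t : nattrans K L) : nattrans F L :=
  NatTrans (ntM_subproof s t).

Fact ntV_subproof F K (s : nattrans F K) (a b : C) (f : mor a b) :
  seqm (fmap K f) (invm (s b)) = seqm (invm (s a)) (fmap F f).
Proof.
have -> : fmap K f = seqm (invm (s a)) (seqm (fmap F f) (s b)).
  by rewrite ntP seqmA seqVm seq1m.
by rewrite -!seqmA seqmV seqm1.
Qed.
Let ntV F K (s : nattrans F K) : nattrans K F := NatTrans (ntV_subproof s).

Fact ntM1l F K (s : nattrans F K) : ntM (nt1 F) s = s.
Proof. by apply: nattransP => a /=; rewrite seq1m. Qed.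
Fact ntM1r F K (s : nattrans F K) : ntM s (nt1 K) = s.
Proof. by apply: nattransP => a /=; rewrite seqm1. Qed.
Fact ntMA F K L M (s : nattrans F K) (t : nattrans K L) (u : nattrans L M) :
  ntM s (ntM t u) = ntM (ntM s t) u.
Proof. by apply: nattransP => a /=; rewrite seqmA. Qed.
Fact ntMVl F K (s : nattrans F K) : ntM (ntV s) s = nt1 K.
Proof. by apply: nattransP => a /=; rewrite seqVm. Qed.
Fact ntMVr F K (s : nattrans F K) : ntM s (ntV s) = nt1 F.
Proof. by apply: nattransP => a /=; rewrite seqmV. Qed.

Definition homgpd : groupoid :=
  @Groupoid (Category ntM1l ntM1r ntMA) ntV ntMVl ntMVr.

Let ev_ob (a : prodcat C homgpd) : D := a.2 a.1.
Let ev_map (a b : prodcat C homgpd) (f : mor a b) : mor (ev_ob a) (ev_ob b) :=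
  seqm (fmap a.2 f.1) (f.2 b.1).

Fact ev1 a : ev_map (idm a) = idm (ev_ob a).
Proof. by rewrite /ev_map /= fmap1 seq1m. Qed.
Fact evM a b c (f : mor a b) (g : mor b c) :
  ev_map (seqm f g) = seqm (ev_map f) (ev_map g).
Proof.
rewrite /ev_map /= fmapM -!seqmA; congr seqm.
by rewrite !seqmA; congr seqm; rewrite ntP.
Qed.

Definition evalfun : functor (prodcat C homgpd) D := Functor ev1 evM.
End FunctorGroupoid.

(* The n-simplices of the nerve of C are the functors [n] -> C, where [n] is
   the poset {0 < ... < n}. *)

Definition ordcat (n : nat) : category :=
  @Category 'I_n.+1 (fun i j => (i <= j)%N) (fun i => leqnn i)
    (fun i j k ij jk => leq_trans ij jk)
    (fun _ _ _ => bool_irrelevance _ _) (fun _ _ _ => bool_irrelevance _ _)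
    (fun _ _ _ _ _ _ _ => bool_irrelevance _ _).

Definition simplex (n : nat) (C : category) := functor (ordcat n) C.

Definition edge (n : nat) (C : category) (s : simplex n C) (i : 'I_n) :
    mor (s (widen_ord (leqnSn n) i)) (s (lift ord0 i)) :=
  @fmap _ _ s (widen_ord (leqnSn n) i) (lift ord0 i) (leqnSn i).

(* In a groupoid, an n-simplex is given by morphisms p i from a common source
   to its vertices v i: its edge i -> j is (p i)^-1 followed by p j. *)
Section ConeSimplex.
Variables (C : groupoid) (n : nat) (a : C) (v : nat -> C).
Variable p : forall i, mor a (v i).

Let cone_map (i j : ordcat n) (_ : mor i j) : mor (v i) (v j) :=
  seqm (invm (p i)) (p j).

Fact cone1 i : cone_map (idm i) = idm (v i).
Proof. exact: seqVm. Qed.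
Fact coneM i j k (f : mor i j) (g : mor j k) :
  cone_map (seqm f g) = seqm (cone_map f) (cone_map g).
Proof. by rewrite /cone_map -seqmA (seqmA (p j)) seqmV seq1m. Qed.

Definition cone_simplex : simplex n C :=
  @Functor (ordcat n) C (fun i => v i) cone_map cone1 coneM.
End ConeSimplex.

Definition simplex1 (C : groupoid) (a b : C) (f : mor a b) : simplex 1 C :=
  @cone_simplex C 1 a (fun i => if i is 0 then a else b)
    (fun i => if i is 0 then idm a else f).

Definition simplex2 (C : groupoid) (a b c : C) (f : mor a b) (g : mor b c) :
    simplex 2 C :=
  @cone_simplex C 2 a
    (fun i => match i with 0 => a | 1 => b | _ => c end)
    (fun i => match i with 0 => idm a | 1 => f | _ => seqm f g end).

(* A (p,q)-shuffle, encoded by the set S of the p steps (out of p + q) that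
   are taken in the first direction; it is a maximal chain of [p] x [q]. *)

Definition shuffle (p q : nat) := {S : {set 'I_(p + q)} | #|S| == p}.

Section Shuffle.
Variables (p q : nat) (S : shuffle p q).

Let steps (A : {set 'I_(p + q)}) (m : nat) : nat :=
  #|[set i in A | (i < m)%N]|.

Fact steps_mono A m n : (m <= n)%N -> (steps A m <= steps A n)%N.
Proof.
move=> mn; apply/subset_leq_card/subsetP => i.
by rewrite !inE => /andP[-> im] /=; apply: leq_trans mn.
Qed.
Fact steps1_subproof m : (steps (val S) m < p.+1)%N.
Proof.
rewrite ltnS -[leqRHS](eqP (valP S)).
by apply/subset_leq_card/subsetP => i; rewrite inE => /andP[].
Qed.
Fact steps2_subproof m : (steps (~: val S) m < q.+1)%N.
Proof.
have cardSC : #|~: val S| = q.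
  by rewrite cardsCs setCK card_ord (eqP (valP S)) addKn.
rewrite ltnS -[leqRHS]cardSC.
by apply/subset_leq_card/subsetP => i; rewrite inE => /andP[].
Qed.

Let shuffle_ob (m : ordcat (p + q)) : prodcat (ordcat p) (ordcat q) :=
  (Ordinal (steps1_subproof m), Ordinal (steps2_subproof m)).
Let shuffle_map (m n : ordcat (p + q)) (mn : mor m n) :
    mor (shuffle_ob m) (shuffle_ob n) :=
  (steps_mono (val S) mn, steps_mono (~: val S) mn).

Fact shuffle1 m : shuffle_map (idm m) = idm (shuffle_ob m).
Proof. by congr pair; apply: bool_irrelevance. Qed.
Fact shuffleM m n k (f : mor m n) (g : mor n k) :
  shuffle_map (seqm f g) = seqm (shuffle_map f) (shuffle_map g).
Proof. by congr pair; apply: bool_irrelevance. Qed.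

Definition shuffle_simplex :
    simplex (p + q) (prodcat (ordcat p) (ordcat q)) :=
  Functor shuffle1 shuffleM.

(* Inversions of the permutation listing S, then its complement. *)
Definition shuffle_inversions : nat :=
  #|[set ij : 'I_(p + q) * 'I_(p + q) |
     [&& ij.1 \in val S, ij.2 \notin val S & (ij.2 < ij.1)%N]]|.
End Shuffle.

Section Cocycles.
Variable R : realType.

(* Value of a cochain on the Eilenberg-Zilber shuffle product of the top cells
   of [p] and [q], mapped to D by P. *)
Definition EZ_eval (p q : nat) (D : category) (c : simplex (p + q) D -> U1 R)
    (P : functor (prodcat (ordcat p) (ordcat q)) D) : U1 R :=
  \prod_(S : shuffle p q)
    (let u := c (fcomp (shuffle_simplex S) P) in
     if odd (shuffle_inversions S) then u^-1 else u).

Definition gpd_2cochain (C : groupoid) :=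
  forall a b c : C, mor a b -> mor b c -> U1 R.

Definition gpd_2cocycle (C : groupoid) (t : gpd_2cochain C) : Prop :=
  forall (a b c d : C) (f : mor a b) (g : mor b c) (h : mor c d),
    t _ _ _ f g * t _ _ _ (seqm f g) h = t _ _ _ g h * t _ _ _ f (seqm g h).

Definition gpd_2cochain_normalized (C : groupoid) (t : gpd_2cochain C) : Prop :=
  forall (a b : C) (f : mor a b),
    t _ _ _ (idm a) f = 1 /\ t _ _ _ f (idm b) = 1.

(* [t] is a morphism C -> B^2 U(1): as for B^3 U(1) below, it must also be
   trivial on degenerate simplices. *)
Definition gpd_to_B2U1 (C : groupoid) (t : gpd_2cochain C) : Prop :=
  gpd_2cocycle t /\ gpd_2cochain_normalized t.

(* hom(C, c)_1 evaluated on the 1-cell e of C: a composable pair (f, g) of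
   hom(C, D) gives the prism Delta^1 x Delta^2 -> C x hom(C, D) -> D, on which
   c is evaluated. *)
Definition transgression (C D : groupoid) (c : simplex 3 D -> U1 R)
    (a b : C) (e : mor a b) : gpd_2cochain (homgpd C D) :=
  fun F K L f g =>
    @EZ_eval 1 2 D c
      (fcomp (prodfun (simplex1 e) (simplex2 f g)) (evalfun C D)).

End Cocycles.

(* In BG, g followed by h is h * g. *)

Definition BG (G : groupType) : groupoid :=
  @Groupoid
    (@Category unit (fun _ _ => G) (fun _ => 1) (fun _ _ _ g h => h * g)
      (fun _ _ => @mulg1 G) (fun _ _ => @mul1g G)
      (fun _ _ _ _ f g h => esym (mulgA h g f)))
    (fun _ _ => @inv G) (fun _ _ => @mulgV G) (fun _ _ => @mulVg G).

Definition BZ : groupoid :=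
  @Groupoid
    (@Category unit (fun _ _ => int) (fun _ => 0%R)
      (fun _ _ _ m n => (n + m)%R)
      (fun _ _ => @addr0 int) (fun _ _ => @add0r int)
      (fun _ _ _ _ f g h => esym (addrA h g f)))
    (fun _ _ => @GRing.opp int) (fun _ _ => @subrr int)
    (fun _ _ => @addNr int).

Definition BZgen : @mor BZ tt tt := 1%R.

Section GroupCocycles.
Variables (R : realType) (G : groupType).

Definition group_3cochain_normalized (alpha : G -> G -> G -> U1 R) : Prop :=
  forall g h, [/\ alpha 1 g h = 1, alpha g 1 h = 1 & alpha g h 1 = 1].

Definition group_3cocycle (alpha : G -> G -> G -> U1 R) : Prop :=
  forall g h k l,
    alpha g h k * alpha g (k * h) l * alpha h k l =
    alpha (h * g) k l * alpha g h (l * k).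

Definition BG_to_B3U1 (alpha : G -> G -> G -> U1 R) : Prop :=
  group_3cochain_normalized alpha /\ group_3cocycle alpha.

Definition nerve_cochain (alpha : G -> G -> G -> U1 R)
    (s : simplex 3 (BG G)) : U1 R :=
  alpha (edge s (@Ordinal 3 0 isT)) (edge s (@Ordinal 3 1 isT))
        (edge s (@Ordinal 3 2 isT)).

Definition Loop : groupoid := homgpd BZ (BG G).

Definition transgression_BZ (alpha : G -> G -> G -> U1 R) :
    gpd_2cochain R Loop :=
  transgression (nerve_cochain alpha) BZgen.
End GroupCocycles.

(* An element x of G is identified with the functor n |-> x ^ n, and g with the
   natural transformation x --g--> g x g^-1; loop_surj and loop_mor_surj show
   that Loop G has no other objects and morphisms. *)

Section LoopGroupoid.
Variable G : groupType.
Implicit Types x y g : G.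

Definition expgz x (n : int) : G :=
  match n with Posz m => x ^+ m | Negz m => x ^- m.+1 end.

Lemma expgzS x (n : int) : expgz x (1 + n)%R = x * expgz x n.
Proof.
case: n => [n|[|n]]; first by rewrite /= expgS.
  by rewrite /= expg1 mulgV.
have -> : (1 + Negz n.+1)%R = Negz n.
  by rewrite !NegzE [Posz n.+2]intS opprD addNKr.
by rewrite /= [x ^+ n.+2]expgSr invgM mulVKg.
Qed.

Lemma expgzD x (m n : int) : expgz x (m + n)%R = expgz x m * expgz x n.
Proof.
elim/int_rec: m => [|m IH|m IH]; first by rewrite add0r /= mul1g.
  by rewrite intS -addrA !expgzS IH mulgA.
apply: (mulgI x); rewrite -expgzS mulgA -expgzS.
by rewrite addrA intS opprD addNKr IH.
Qed.

Definition loop x : Loop G :=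
  @Functor BZ (BG G) (fun _ => tt) (fun _ _ n => expgz x n)
    (fun _ => erefl) (fun _ _ _ m n => expgzD x n m).

Lemma expgzJ x g (n : int) :
  g * expgz x n = expgz (g * x * g^-1) n * g.
Proof.
elim/int_rec: n => [|n IH|n IH]; first by rewrite /= mulg1 mul1g.
  by rewrite intS !expgzS -[RHS]mulgA -IH !mulgA mulgKV.
apply: (mulgI (g * x * g^-1)); rewrite [RHS]mulgA -expgzS mulgA mulgKV.
by rewrite -mulgA -expgzS intS opprD addNKr IH.
Qed.

Definition loop_mor x g : @mor (Loop G) (loop x) (loop (g * x * g^-1)) :=
  @NatTrans BZ (BG G) (loop x) (loop (g * x * g^-1)) (fun _ => g)
    (fun _ _ n => expgzJ x g n).

Lemma loop_surj (F : Loop G) : F = loop (fmap F BZgen).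
Proof.
case: F => Fo Fm F1 FM.
have Fo_tt : Fo = fun _ => tt.
  by apply: functional_extensionality_dep => u; case: (Fo u).
subst Fo; rewrite /loop /=; move: (expgzD _) => eD.
have Fm_exp : Fm = fun _ _ n => expgz (Fm tt tt BZgen) n.
  do 2![apply: functional_extensionality_dep => -[]].
  apply: functional_extensionality_dep => n.
  have FS k : Fm tt tt (1 + k)%R = Fm tt tt BZgen * Fm tt tt k.
    exact: FM k BZgen.
  elim/int_rec: n => [|n IH|n IH]; first exact: F1.
    by rewrite intS FS IH -expgzS.
  by apply: (mulgI (Fm tt tt BZgen)); rewrite -FS -expgzS intS opprD addNKr.
move: (Fm tt tt BZgen) Fm_exp eD => x Fm_exp eD; subst Fm.
by congr Functor; apply: Prop_irrelevance.
Qed.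

Lemma loop_mor_surj x (F : Loop G) (s : mor (loop x) F) :
  exists g, existT (mor (loop x)) F s =
            existT (mor (loop x)) (loop (g * x * g^-1)) (loop_mor x g).
Proof.
move: s; rewrite (loop_surj F); move: (fmap F BZgen) => y s.
have sx : s tt * x = y * s tt by exact: ntP s tt tt BZgen.
have [g sg] : exists g, s tt = g by exists (s tt).
rewrite sg in sx; have {}sx : y = g * x * g^-1 by rewrite sx mulgK.
by subst y; exists g; congr existT; apply: nattransP => -[].
Qed.
End LoopGroupoid.

(* Main.v *)
Require Import Defs.
From mathcomp Require Import all_boot fingroup.
From mathcomp Require Import reals.
From mathcomp Require Import ssralg ssrint complex ring.

(** A shuffle of the 1-cell with the 2-cell is determined by the position at
    which the 1-cell is traversed, and this position is also the number of
    inversions. The three tetrahedra of the prism are therefore (x, g, h),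
    (g, x1, h) and (g, h, x2), with signs +, -, +, where x1 and x2 are the
    successive conjugates of x. The cocycle identity is the alternating product
    of the 3-cocycle identities at (x, g, h, k), (g, x1, h, k), (g, h, x2, k)
    and (g, h, k, x3). *)

Set Implicit Arguments.
Unset Strict Implicit.
Unset Printing Implicit Defensive.

Import GRing.Theory.

Local Open Scope group_scope.

Lemma widen_ord_inj n m (le_nm : (n <= m)%N) : injective (widen_ord le_nm).
Proof. by move=> i j /(congr1 val) /= ij; apply: val_inj. Qed.

Section OneShuffles.
Variable q : nat.

Definition shuffle1_at (i : 'I_(1 + q)) : shuffle 1 q :=
  exist _ [set i] (introT eqP (cards1 i)).

(** Injectivity suffices, since there are only ['C(1 + q, 1)] one-element sets of steps. *)
Lemma shuffle1_at_bij : bijective shuffle1_at.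
Proof.
apply: inj_card_bij => [i j [/set1_inj]//|].
rewrite card_sig card_ord.
rewrite -[X in (_ <= X)%N](bin1 (1 + q)) -[X in 'C(X, 1)]card_ord.
by rewrite -card_draws cardsE.
Qed.

Lemma shuffle1_at_ob (i : 'I_(1 + q)) (m : 'I_(1 + q).+1) :
  let v := shuffle_simplex (shuffle1_at i) m in
  (v.1 = (i < m)%N :> nat) * (v.2 = (m - (i < m))%N :> nat).
Proof.
move=> v.
have v1 : v.1 = (i < m)%N :> nat.
  rewrite /v /=; case: (ltnP i m) => im; last first.
    apply/eqP; rewrite cards_eq0; apply/eqP/setP => j; rewrite !inE.
    by apply/negP => /andP[/eqP ->]; rewrite ltnNge im.
  rewrite -[RHS](cards1 i); apply: eq_card => j; rewrite !inE.
  by case: eqP => // ->.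
split=> //.
(* Each of the first [m] steps lies either in [[set i]] or in its complement. *)
have vD : (v.1 + v.2 = m)%N.
  rewrite /v /= -cardsUI.
  rewrite [X in (_ + X)%N](_ : _ = 0%N) ?addn0; last first.
    apply/eqP; rewrite cards_eq0; apply/eqP/setP => j; rewrite !inE.
    by case: eqP; rewrite ?andbF.
  rewrite -[RHS]card_ord -cardsT.
  have lem : (m <= 1 + q)%N := ltn_ord m.
  rewrite -(card_imset _ (@widen_ord_inj _ _ lem)).
  apply: eq_card => j; rewrite !inE -andb_orl orbN /=.
  apply/idP/imsetP => [jm|[k _ ->]]; last by case: k.
  by exists (Ordinal jm); rewrite ?inE //; apply: val_inj.
by rewrite -v1 -vD addKn.
Qed.

(** The inversions are the pairs [(i, k)] with [k < i]. *)
Lemma shuffle1_at_inversions i : shuffle_inversions (shuffle1_at i) = i.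
Proof.
have lei : (i <= 1 + q)%N := ltnW (ltn_ord i).
rewrite /shuffle_inversions -[RHS]card_ord -cardsT.
have pair_inj : injective (pair i : 'I_(1 + q) -> _) by move=> j k [].
rewrite -(card_imset _ (inj_comp pair_inj (@widen_ord_inj _ _ lei))).
apply: eq_card => -[j k]; rewrite !inE /=; apply/and3P/imsetP.
  case=> /eqP -> _ ki; exists (Ordinal ki); rewrite ?inE //.
  by congr pair; apply: val_inj.
case=> l _ [-> ->]; split=> //=.
by rewrite -val_eqE /= neq_ltn ltn_ord.
Qed.

End OneShuffles.

Section LoopPrism.
Variables (R : realType) (G : groupType) (alpha : G -> G -> G -> U1 R).
Variables (F K L : Loop G) (f : mor F K) (g : mor K L).

Let prism :=
  fcomp (prodfun (simplex1 BZgen) (simplex2 f g)) (evalfun BZ (BG G)).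

Let vertex (i : nat) : Loop G := match i with 0 => F | 1 => K | _ => L end.
Let ray (i : nat) : G :=
  match i with 0 => 1 | 1 => f tt | _ => g tt * f tt end.
Let time (i : nat) : int := if i is 0 then 0%R else 1%R.

(* Vertices are pairs of numbers rather than of ordinals, so that the vertices
   of a shuffle, which are cardinals, can be rewritten in it. *)
Definition prism_edge (a b : nat * nat) : G :=
  ray b.2 * (ray a.2)^-1 *
    @fmap BZ (BG G) (vertex a.2) tt tt (time b.1 - time a.1)%R.

(** Evaluation first runs along the loop at [vertex a.2], then crosses to [vertex b.2]; once the
    coordinates are split into cases, both sides compute. *)
Lemma fmap_prism a b (m : mor a b) :
  fmap prism m = prism_edge (a.1 : nat, a.2 : nat) (b.1 : nat, b.2 : nat) :> G.
Proof.
by case: a b m => [[[|a1] ?] [[|[|a2]] ?]] [[[|b1] ?] [[|[|b2]] ?]] m.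
Qed.

Lemma nerve_cochain_prism (i : 'I_3) :
  let step (m : nat) :=
    prism_edge ((i < m)%N : nat, (m - (i < m))%N)
               ((i < m.+1)%N : nat, (m.+1 - (i < m.+1))%N) in
  nerve_cochain alpha (fcomp (shuffle_simplex (shuffle1_at i)) prism) =
  alpha (step 0%N) (step 1%N) (step 2%N).
Proof.
have edgeE (k : 'I_3) :
    edge (fcomp (shuffle_simplex (shuffle1_at i)) prism) k =
    prism_edge ((i < k)%N : nat, (k - (i < k))%N)
               ((i < k.+1)%N : nat, (k.+1 - (i < k.+1))%N) :> G.
  by rewrite [LHS]fmap_prism !(@shuffle1_at_ob 2).
by move=> step; rewrite /nerve_cochain !edgeE.
Qed.

(** Kept for arbitrary loops, so that it applies to any composable pair without first writing its
    objects as [loop x]. *)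
Lemma transgression_BZE :
  transgression_BZ alpha f g =
  alpha (fmap F BZgen) (f tt) (g tt) * alpha (f tt) (g tt) (fmap L BZgen) /
    alpha (f tt) (fmap K BZgen) (g tt).
Proof.
rewrite /transgression_BZ /transgression /EZ_eval.
rewrite (reindex _ (onW_bij _ (shuffle1_at_bij 2))).
under eq_bigr => i _ do rewrite nerve_cochain_prism shuffle1_at_inversions.
rewrite !big_ord_recl big_ord0 /= /prism_edge /=.
have fmap0 (M : Loop G) : @fmap BZ (BG G) M tt tt 0%R = 1.
  exact: (@fmap1 _ _ M tt).
(* Along a loop edge the rays cancel; along a crossing edge the time difference is 0. *)
rewrite !subrr !subr0 !fmap0 !invg1 !mulg1 !mul1g mulgK !mulgV !mul1g.
by rewrite -[RHS]mulgA [X in _ * X = _]U1mulC.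
Qed.

End LoopPrism.

(** The commutation relations identify the values shared by successive 3-cocycle identities, such as
    [alpha (x1 * g) h k] for the first two. *)
Lemma slant_product_cocycle (R : realType) (G : groupType)
    (alpha : G -> G -> G -> U1 R) (x x1 x2 x3 g h k : G) :
    group_3cocycle alpha ->
    g * x = x1 * g -> h * x1 = x2 * h -> k * x2 = x3 * k ->
  alpha x g h * alpha g h x2 / alpha g x1 h *
    (alpha x (h * g) k * alpha (h * g) k x3 / alpha (h * g) x2 k) =
  alpha x1 h k * alpha h k x3 / alpha h x2 k *
    (alpha x g (k * h) * alpha g (k * h) x3 / alpha g x1 (k * h)).
Proof.
move=> cocycle gx hx kx.
have := congr1 (@U1val R) (cocycle g h k x3).
have := congr1 (@U1val R) (cocycle g h x2 k).
have := congr1 (@U1val R) (cocycle g x1 h k).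
have := congr1 (@U1val R) (cocycle x g h k).
rewrite gx hx kx /= => cx cx1 cx2 cx3; apply: val_inj => /=.
have nz p q r := U1_neq0 (alpha p q r).
have {}cx := canRL (mulfK (nz _ _ _)) (canRL (mulfK (nz _ _ _)) cx).
have {}cx1 := canLR (mulKf (nz _ _ _)) cx1.
have {}cx2 := canLR (mulKf (nz _ _ _)) cx2.
have {}cx3 := canLR (mulfK (nz _ _ _)) cx3.
(* Each identity is solved for one value; [cx3] precedes [cx2] because it introduces
   [alpha g h (x3 * k)], which [cx2] eliminates. *)
rewrite cx -cx1 -cx3 -cx2.
by field; rewrite !nz.
Qed.

Theorem proposition9p1 (R : realType) (G : finGroupType)
    (alpha : G -> G -> G -> U1 R) (alphaP : BG_to_B3U1 alpha) :
  gpd_to_B2U1 (transgression_BZ alpha) /\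
  forall x g h : G,
    transgression_BZ alpha (loop_mor x g) (loop_mor (g * x * g^-1) h) =
    alpha x g h * alpha g h ((h * g) * x * (h * g)^-1) /
      alpha g (g * x * g^-1) h.
Proof.
case: alphaP => alpha1 cocycle; split=> [|x g h]; last first.
  by rewrite transgression_BZE /= !expg1 invgM !mulgA.
split=> [F K L M f g h|F K f].
  rewrite !transgression_BZE; apply: slant_product_cocycle => //.
  (* Naturality at the generator is the required commutation relation. *)
  - exact: (ntP f BZgen).
  - exact: (ntP g BZgen).
  - exact: (ntP h BZgen).
have [al1 al2 al3] : [/\ forall p q, alpha 1 p q = 1,
    forall p q, alpha p 1 q = 1 & forall p q, alpha p q 1 = 1].
  by split=> p q; case: (alpha1 p q).
(* An identity morphism in the pair gives an argument 1 in all three factors. *)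
by rewrite !transgression_BZE /= !al1 !al2 !al3 invg1 !mulg1.
Qed.
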